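(* Let $\varepsilon>0$ and let $G$ be a finite $\varepsilon$-quasirandom group. Then every element of $G$ is the product of at most $\varepsilon^{-1}$ commutators.
   Context: A finite group $G$ is $\varepsilon$-quasirandom if every nontrivial irreducible complex representation of $G$ has degree at least $|G|^{\varepsilon}$. A commutator is an element of the form $[x,y]=x^{-1}y^{-1}xy$ with $x,y\in G$; the empty product is the identity. *)

(* Defs.v *)
From mathcomp Require Import all_boot all_order all_algebra all_fingroup all_character.
From mathcomp Require Import reals exp.
From mathcomp.real_closed Require Import complex.

Set Implicit Arguments.
Unset Strict Implicit.
Unset Printing Implicit Defensive.

Import GRing.Theory Num.Theory.

Local Open Scope ring_scope.

(* [R] is a model of the real numbers, so that [complex R] is the field of
   complex numbers; [`^] is real exponentiation. The degree of
   [rG : mx_representation _ G n] is [n], and [rG] is trivial iff its kernel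
   [rker rG] is the whole of [G]. [mx_irreducible] excludes [n = 0]. *)
Definition quasirandom (R : realType) (eps : R) (gT : finGroupType)
    (G : {group gT}) : Prop :=
  forall (n : nat) (rG : mx_representation (complex R) G n),
    mx_irreducible rG -> rker rG != G :> {set gT} ->
    #|G|%:R `^ eps <= n%:R.

(* Main.v *)
(** Let [N k g] be the number of ways of writing [g] as a product of [k]
    commutators of elements of [G]. By Schur's lemma the sum of [rho [~ x, y]]
    over all [x, y] is the scalar [(#|G| / n)^2] for each irreducible [rho] of
    degree [n]; expanding the regular character then gives Frobenius' formula
    [#|G| * N k g = \sum_rho n_rho * (#|G| / n_rho)^(2k) * \tr (rho g)].
    If [n_rho^(2k) >= #|G|] for every nontrivial [rho], then, relative to the
    contribution of the trivial representation, the other terms add up to at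
    most [\sum_(rho <> 1) n_rho^2 / #|G| = (#|G| - 1) / #|G| < 1], so that
    [N k g] is nonzero. For [eps <= 1], [k = floor (1 / eps)] satisfies
    [2 k eps >= 1]; for [eps > 1] the sum of the squares of the degrees forces
    [G] to be trivial. *)

Require Import Defs.
From mathcomp Require Import all_boot all_order all_algebra all_fingroup.
From mathcomp Require Import all_solvable all_character.
From mathcomp Require Import reals exp.
From mathcomp.real_closed Require Import complex.

Set Implicit Arguments.
Unset Strict Implicit.
Unset Printing Implicit Defensive.

Import Order.TTheory GRing.Theory Num.Theory.

Local Open Scope ring_scope.

Section AbsolutelyIrreducible.
Variables (F : fieldType) (gT : finGroupType) (G : {group gT}) (n : nat).
Variable rG : mx_representation F G n.
Hypothesis absG : mx_absolutely_irreducible rG.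
Hypothesis n_neq0 : n%:R != 0 :> F.

(** Reindexing shows that the sum commutes with every [rG x], so Schur's lemma makes it scalar. Its
    trace [#|G| * \tr A] then determines the scalar, as [n] is invertible in [F]. *)
Lemma sum_conj_scalar (A : 'M[F]_n) :
  \sum_(y in G) rG y^-1%g *m A *m rG y = (#|G|%:R * \tr A / n%:R)%:M.
Proof.
set B := \sum_(y in G) _.
have trB : \tr B = #|G|%:R * \tr A.
  rewrite raddf_sum /= (eq_bigr (fun=> \tr A)); last first.
    move=> y Gy; rewrite mxtrace_mulC mulmxA repr_mxV //.
    by rewrite mulmxV ?mul1mx ?repr_mx_unit.
  by rewrite sumr_const mulr_natl.
have cB : centgmx rG B.
  apply/centgmxP => x Gx; rewrite mulmx_suml mulmx_sumr.
  rewrite (reindex_inj (mulIg x^-1%g)) /=; apply: eq_big => y.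
    by rewrite groupMr ?groupV.
  move=> Gyx; have Gy : y \in G by rewrite -(groupMr y (groupVr Gx)).
  by rewrite invMg invgK !repr_mxM ?groupV // !mulmxA repr_mxKV.
have /is_scalar_mxP[c Bc] := mx_abs_irr_cent_scalar absG cB.
by rewrite -trB Bc mxtrace_scalar -[c *+ n]mulr_natr mulfK.
Qed.

Lemma sum_trace_repr_inv :
  \sum_(x in G) \tr (rG x) *: rG x^-1%g = (#|G|%:R / n%:R)%:M.
Proof.
apply/matrixP => a b.
(* The [(a, b)] entry is read off [sum_conj_scalar] for the matrix units. *)
transitivity (\sum_j (\sum_(x in G) rG x^-1%g *m delta_mx b j *m rG x) a j).
  under [RHS]eq_bigr do rewrite summxE.
  rewrite exchange_big summxE /=; apply: eq_bigr => x Gx.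
  rewrite mxE [X in X * _]/mxtrace mulr_suml; apply: eq_bigr => j _.
  rewrite -mulmxA mxE (bigD1 b) //= big1 => [|i /negPf ib].
    rewrite addr0 mulrC; congr (_ * _).
    rewrite mxE (bigD1 j) //= big1 => [|k /negPf kj]; rewrite !mxE.
      by rewrite !eqxx mul1r addr0.
    by rewrite kj andbF mul0r.
  by rewrite mxE big1 ?mulr0 // => k _; rewrite mxE ib mul0r.
have trE j : \tr (delta_mx b j : 'M[F]_n) = (b == j)%:R.
  rewrite /mxtrace (bigD1 b) //= big1 => [|k /negPf kb]; rewrite mxE.
    by rewrite eqxx addr0.
  by rewrite kb.
under eq_bigr do rewrite sum_conj_scalar mxE trE.
rewrite (bigD1 a) //= big1 => [|j /negPf aj]; last first.
  by rewrite [a == j]eq_sym aj.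
rewrite eqxx addr0 mulr1n mxE eq_sym.
by case: eqVneq; rewrite ?mulr1 ?mulr0 ?mul0r.
Qed.

(** Since [[~ x, y] = x^-1 * (y^-1 * x * y)], summing over [y] replaces the conjugates of [rG x] by
    a multiple of [\tr (rG x)]. Schur orthogonality then evaluates the sum over [x]; each sum
    contributes a factor [#|G| / n]. *)
Lemma sum_commg_repr :
  \sum_(x in G) \sum_(y in G) rG [~ x, y]%g = ((#|G|%:R / n%:R) ^+ 2)%:M.
Proof.
transitivity (\sum_(x in G) (#|G|%:R / n%:R) *: (\tr (rG x) *: rG x^-1%g)).
  apply: eq_bigr => x Gx.
  transitivity (rG x^-1%g *m \sum_(y in G) rG y^-1%g *m rG x *m rG y).
    rewrite mulmx_sumr; apply: eq_bigr => y Gy.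
    by rewrite -!repr_mxM ?groupM ?groupV // /commg /conjg !mulgA.
  by rewrite sum_conj_scalar mul_mx_scalar scalerA mulrAC.
by rewrite -scaler_sumr sum_trace_repr_inv scale_scalar_mx expr2.
Qed.

End AbsolutelyIrreducible.

(** As [x] has finite order, the eigenvalues of [rG x] are roots of unity, and the trace is a sum of
    [n] of them. *)
Lemma norm_mxtrace_repr (C : numClosedFieldType) (gT : finGroupType)
    (G : {group gT}) (n : nat) (rG : mx_representation C G n) (x : gT) :
  x \in G -> `|\tr (rG x)| <= n%:R.
Proof.
(* The trace is read off the coefficient of degree [n.-1] of the characteristic polynomial, which
   requires [n > 0]. *)
move=> Gx; have [n0|n_gt0] := posnP n.
  rewrite /mxtrace big1 ?normr0 ?ler0n // => i.
  by have := ltn_ord i; rewrite [X in (_ < X)%N]n0.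
have [rs Drs] := closed_field_poly_normal (char_poly (rG x)).
rewrite (monicP (char_poly_monic _)) scale1r in Drs.
have size_rs : size rs = n.
  by have := size_char_poly (rG x); rewrite Drs size_prod_XsubC => -[].
have -> : \tr (rG x) = \sum_(r <- rs) r.
  apply: oppr_inj; rewrite -char_poly_trace // Drs -size_rs coefPn_prod_XsubC //.
  by rewrite size_rs -lt0n.
have norm_rs r : r \in rs -> `|r| = 1.
  rewrite -root_prod_XsubC -Drs -eigenvalue_root_char => /eigenvalueP[v Dv nz_v].
  have DvX k : v *m rG (x ^+ k)%g = r ^+ k *: v.
    elim: k => [|k IHk]; first by rewrite expg0 repr_mx1 mulmx1 scale1r.
    by rewrite expgSr repr_mxM ?groupX // mulmxA IHk -scalemxAl Dv scalerA -exprSr.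
  have : r ^+ #[x]%g = 1.
    apply/eqP; rewrite -subr_eq0; have := DvX #[x]%g.
    rewrite expg_order repr_mx1 mulmx1 => /esym/eqP.
    by rewrite -{2}[v]scale1r -subr_eq0 -scalerBl scaler_eq0 (negPf nz_v) orbF.
  move/(congr1 Num.norm)/eqP; rewrite normrX normr1.
  by rewrite pexpr_eq1 ?order_gt0 // => /eqP.
apply: le_trans (ler_norm_sum _ _ _) _.
by rewrite (eq_big_seq (fun=> 1)) // big_const_seq count_predT iter_addr_0 size_rs.
Qed.

(** The trace counts the fixed points of right multiplication by [x] on [G]. *)
Lemma mxtrace_regular_repr (F : fieldType) (gT : finGroupType)
    (G : {group gT}) (x : gT) :
  x \in G -> \tr (regular_repr F G x) = #|G|%:R *+ (x == 1%g).
Proof.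
move=> Gx; rewrite /mxtrace /=.
under eq_bigr => i _.
  rewrite !mxE eqxx /= -[i in X in (X == _)]gring_valK.
  rewrite (can_in_eq (@gring_indexK _ G)) ?groupM ?enum_valP //.
  rewrite -{1}[enum_val i]mulg1 (inj_eq (mulgI _)) eq_sym; over.
by rewrite sumr_const card_ord; case: (x == 1%g); rewrite ?mulr0n ?mul0rn.
Qed.

(* Counts the solutions of [[~ x_1, y_1] * ... * [~ x_k, y_k] * g = 1], that is,
   the factorizations of [g] as a product of [k] commutators, since
   [[~ x, y]^-1 = [~ y, x]]. *)
Fixpoint commg_count (gT : finGroupType) (G : {group gT}) k (g : gT) : nat :=
  if k is k'.+1 then
    \sum_(x in G) \sum_(y in G) commg_count G k' ([~ x, y] * g)%g
  else (g == 1%g).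

Lemma commg_count_prod (gT : finGroupType) (G : {group gT}) k (g : gT) :
  commg_count G k g != 0%N -> exists s : seq gT,
    [/\ size s = k,
        (forall c : gT, c \in s ->
           exists x y : gT, [/\ x \in G, y \in G & c = [~ x, y]%g])
      & g = (\prod_(c <- s) c)%g].
Proof.
elim: k g => [|k IHk] g /=.
  rewrite eqb0 negbK => /eqP ->; exists [::]; split=> //; first by rewrite big_nil.
rewrite sum_nat_eq0 => /forallPn[x]; rewrite negb_imply => /andP[Gx].
rewrite sum_nat_eq0 => /forallPn[y]; rewrite negb_imply => /andP[Gy].
move=> /IHk[s [sz_s s_comm Dg]]; exists ([~ y, x]%g :: s); split=> /=.
- by rewrite sz_s.
- by move=> c; rewrite inE => /predU1P[->|/s_comm //]; exists y, x.
- by rewrite big_cons -Dg -invg_comm mulKg.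
Qed.

Section FrobeniusFormula.
Variables (C : numClosedFieldType) (gT : finGroupType) (G : {group gT}).
Variable sG : irrType C G.

Let splitG : group_splitting_field C G.
Proof. exact: group_closure_closed_field. Qed.

Let pcharG : ([pchar C]^'.-group G)%g.
Proof. by apply/pgroupP=> p _ _; rewrite inE /= pchar_num. Qed.

Lemma irr_degree_neq0 (i : sG) : (irr_degree i)%:R != 0 :> C.
Proof. by rewrite pnatr_eq0 -lt0n irr_degree_gt0. Qed.

(** Induction on [k]: the base case decomposes the regular character, and each further commutator
    multiplies the term of [i] by the scalar of [sum_commg_repr]. *)
Lemma commg_count_formula k (g : gT) : g \in G ->
  (#|G| * commg_count G k g)%:R =
    \sum_(i : sG) (irr_degree i)%:R
      * ((#|G|%:R / (irr_degree i)%:R) ^+ 2) ^+ k * \tr (irr_repr i g).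
Proof.
elim: k g => [|k IHk] g Gg /=.
  rewrite natrM mulr_natr -mxtrace_regular_repr // (mxtrace_regular_pchar sG) //.
  by apply: eq_bigr => i _; rewrite expr0 mulr1 mulr_natl.
rewrite natrM natr_sum mulr_sumr.
transitivity (\sum_(x in G) \sum_(y in G) \sum_(i : sG)
    (irr_degree i)%:R * ((#|G|%:R / (irr_degree i)%:R) ^+ 2) ^+ k
      * \tr (irr_repr i ([~ x, y] * g)%g) : C).
  apply: eq_bigr => x Gx; rewrite natr_sum mulr_sumr; apply: eq_bigr => y Gy.
  by rewrite -natrM IHk // groupM ?groupR.
rewrite (eq_bigr _ (fun x _ => exchange_big _ _ _ _ _ _)) exchange_big /=.
apply: eq_bigr => i _; under eq_bigr do rewrite -mulr_sumr -raddf_sum /=.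
rewrite -mulr_sumr -raddf_sum /=; move Dc: (_ ^+ 2) => c.
rewrite exprSr mulrA -[RHS]mulrA; congr (_ * _).
rewrite -mxtraceZ -mul_scalar_mx -{}Dc.
rewrite -(sum_commg_repr (splitG (socle_irr i)) (irr_degree_neq0 i)).
congr (\tr _); rewrite mulmx_suml; apply: eq_bigr => x Gx.
by rewrite mulmx_suml; apply: eq_bigr => y Gy; rewrite repr_mxM ?groupR.
Qed.

(** If [G] acts trivially on [socle_base i], this module lies in the fixed space of the regular
    representation, which is the principal component. *)
Lemma rker_irr_repr_neq (i : sG) :
  i != principal_comp sG -> rker (irr_repr i) != G :> {set gT}.
Proof.
apply: contra => /eqP kerG; apply/eqP.
have comp_i (j : sG) : (socle_base i <= j)%MS -> irr_comp sG (irr_repr i) = j.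
  by move=> le_ij; apply: irr_comp_id_pchar => //; apply: socle_simple.
rewrite -[LHS]comp_i; last exact/component_mx_id/socle_simple.
apply: comp_i; rewrite irr1_rfix -rfix_mx_rstabC //.
by rewrite -(rker_submod (socle_module i)) [rker _]kerG.
Qed.

Lemma sum_irr_degree_nontrivial :
  (\sum_(i : sG | i != principal_comp sG) irr_degree i ^ 2 = #|G|.-1)%N.
Proof.
have <- := sum_irr_degree_pchar sG pcharG splitG.
by rewrite [in RHS](bigD1 (principal_comp sG)) //= degree_irr1.
Qed.

Lemma commg_count_neq0 k (g : gT) :
  (forall i : sG, i != principal_comp sG -> #|G| <= irr_degree i ^ (2 * k))%N ->
  g \in G -> commg_count G k g != 0%N.
Proof.
move=> big_deg Gg; apply/eqP => count0.
have G_gt0 : 0 < #|G|%:R :> C by rewrite ltr0n cardG_gt0.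
(* [T i] is the term of [i] in Frobenius' formula divided by [#|G| ^ (2 * k)], which normalizes the
   trivial term to 1. *)
pose T (i : sG) : C :=
  (irr_degree i)%:R * \tr (irr_repr i g) / (irr_degree i ^ (2 * k))%:R.
have sumT : \sum_i T i = 0.
  have nzG : #|G|%:R ^+ (2 * k) != 0 :> C by rewrite expf_neq0 // gt_eqF.
  apply: (mulfI nzG); rewrite mulr0 mulr_sumr.
  transitivity ((#|G| * commg_count G k g)%:R : C); last by rewrite count0 muln0.
  rewrite commg_count_formula //; apply: eq_bigr => i _.
  by rewrite -exprM expr_div_n /T natrX mulrCA -mulrA [RHS]mulrA mulrAC.
have T1 : T (principal_comp sG) = 1.
  by rewrite /T irr1_repr // mxtrace1 degree_irr1 exp1n invr1 !mulr1.
have normT i : i != principal_comp sG ->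
      `|T i| <= (irr_degree i ^ 2)%:R / #|G|%:R.
  move=> /big_deg le_G; have n_gt0 := irr_degree_gt0 i.
  rewrite !normrM normfV !normr_nat -mulnn natrM.
  apply: ler_pM; rewrite ?mulr_ge0 ?invr_ge0 ?ler0n //.
    by rewrite ler_wpM2l ?ler0n // norm_mxtrace_repr.
  by rewrite lef_pV2 ?posrE ?ltr0n ?expn_gt0 ?n_gt0 // ler_nat.
(* A vanishing sum makes the trivial term the opposite of the sum of all others, whose norm is below
   1. *)
have : `|T (principal_comp sG)| <= (#|G|.-1)%:R / #|G|%:R.
  move/eqP: sumT; rewrite (bigD1 (principal_comp sG)) //= addr_eq0 => /eqP->.
  rewrite normrN -sum_irr_degree_nontrivial natr_sum mulr_suml.
  by apply: le_trans (ler_norm_sum _ _ _) _; apply: ler_sum => i /normT.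
by rewrite T1 normr1 ler_pdivlMr // mul1r ler_nat leqNgt ltn_predL cardG_gt0.
Qed.

End FrobeniusFormula.

Theorem lemma4p3 (R : realType) (eps : R) (gT : finGroupType) (G : {group gT})
    (eps_gt0 : 0 < eps) (qrG : quasirandom eps G) (g : gT) (gG : g \in G) :
  exists s : seq gT,
    [/\ (size s)%:R <= eps^-1,
        (forall c : gT, c \in s ->
           exists x y : gT, [/\ x \in G, y \in G & c = [~ x, y]%g])
      & g = (\prod_(c <- s) c)%g].
Proof.
have G_ge1 : 1 <= #|G|%:R :> R by rewrite ler1n cardG_gt0.
pose sG : irrType (complex R) G := DecSocleType (regular_repr (complex R) G).
have deg i : i != principal_comp sG -> #|G|%:R `^ eps <= (irr_degree i)%:R :> R.
  by move=> ni; apply: qrG (socle_irr i) (rker_irr_repr_neq ni).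
pose k := Num.truncn eps^-1.
have /andP[le_k lt_k] : k%:R <= eps^-1 < k.+1%:R.
  by apply: truncn_itv; rewrite invr_ge0 ltW.
(* If [k = 0], only the empty product is short enough, so [G] has to be trivial. *)
have [k0|k_gt0] := posnP k.
  have eps_ge1 : 1 <= eps.
    by move: lt_k; rewrite k0 invf_lt1 // => /ltW.
  have G1 : G :=: 1%g.
    apply: card_le1_trivg; rewrite leqNgt; apply/negP => G_gt1.
    have [j nj] : exists j : sG, j != principal_comp sG.
      apply/existsP; apply: contraTT G_gt1 => /existsPn all1.
      rewrite -leqNgt -(prednK (cardG_gt0 G)) -(sum_irr_degree_nontrivial sG).
      by rewrite big_pred0 // => i; apply/negbTE/all1.
    (* This contradicts that the degree is at most its square, hence at most [#|G|.-1]. *)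
    have : (#|G| <= irr_degree j)%N.
      rewrite -(ler_nat R); apply: le_trans (deg _ nj).
      by rewrite -{1}[#|G|%:R]powRr1 ?ler0n // ler_powR.
    rewrite leqNgt => /negP; apply.
    apply: leq_ltn_trans (_ : irr_degree j <= #|G|.-1)%N _; last first.
      by rewrite ltn_predL cardG_gt0.
    rewrite -(sum_irr_degree_nontrivial sG) (bigD1 j) //=.
    apply: leq_trans (leq_addr _ _).
    by rewrite -mulnn leq_pmulr ?(irr_degree_gt0 j).
  exists [::]; split=> //; first by rewrite invr_ge0 ltW.
  by move: gG; rewrite G1 big_nil => /set1P.
have [i ni|s [sz_s s_comm Dg]] :=
  commg_count_prod (@commg_count_neq0 _ _ _ sG k g _ gG).
  rewrite -(ler_nat R) natrX -powR_mulrn ?ler0n //.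
  (* The integer part gives [1 < eps * k.+1], and [k.+1 <= 2 * k] because [k > 0]. Hence [#|G|] is
     at most the power [2 * k] of [#|G| ^ eps], to which the degree bound applies. *)
  have eps2k : 1 <= eps * (2 * k)%:R.
    have : 1 < eps * k.+1%:R by rewrite -ltr_pdivrMl // mulr1.
    move=> /ltW/le_trans-> //; rewrite ler_pM2l // ler_nat.
    by rewrite mul2n -addnn -addn1 leq_add2l.
  rewrite -[leLHS]powRr1 ?ler0n //.
  apply: le_trans (ler_powR G_ge1 eps2k) _; rewrite powRrM.
  by apply: ge0_ler_powR; rewrite ?nnegrE ?ler0n ?powR_ge0 ?deg.
by exists s; split; rewrite ?sz_s.
Qed.
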